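(* For two extended metric spaces $X$ and $Y$, we have $\rho(X,Y)=0$ if and only if $X\sim Y$.
   Context: An extended metric space is a nonempty space with a metric taking values in $[0,+\infty]$. $X\precsim Y$ means that for any finite sequence $x_1,\dots,x_N\in X$ there exist $y_{i,k}\in Y$ ($i=1,\dots,N$, $k=1,2,\dots$) with $d_X(x_i,x_j)\le\liminf_{k\to\infty}d_Y(y_{i,k},y_{j,k})$ for all $i,j$; $X\sim Y$ means $X\precsim Y$ and $Y\precsim X$. $\mathcal{H}$ is the set of isometry classes of (nonempty) compact metric spaces with the Gromov-Hausdorff metric $d_{\mathrm{GH}}$; $\mathcal{H}(N,D)\subset\mathcal{H}$ is the set of those with at most $N$ points and diameter $\le D$; $\mathcal{P}_X:=\{Y\in\mathcal{H}\mid Y\precsim X\}$. Define $\rho_N(X,Y):=d_{\mathrm H}(\mathcal{P}_X\cap\mathcal{H}(N,N),\mathcal{P}_Y\cap\mathcal{H}(N,N))$, with $d_{\mathrm H}$ the Hausdorff distance with respect to $d_{\mathrm{GH}}$, and $\rho(X,Y):=\sum_{N=1}^\infty2^{-N}\rho_N(X,Y)$. *)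

(* Defs.v *)
From HB Require Import structures.
From mathcomp Require Import all_boot all_order all_algebra.
From mathcomp Require Import all_classical all_reals all_analysis.

Set Implicit Arguments.
Unset Strict Implicit.
Unset Printing Implicit Defensive.

Import Order.TTheory GRing.Theory Num.Theory.
Import numFieldNormedType.Exports.

Local Open Scope classical_set_scope.
Local Open Scope ring_scope.
Local Open Scope ereal_scope.

Record extMetricSpace (R : realType) := ExtMetricSpace {
  ext_carrier :> Type;
  ext_dist : ext_carrier -> ext_carrier -> \bar R;
  ext_nonempty : [set: ext_carrier] !=set0;
  ext_dist_ge0 : forall x y, 0 <= ext_dist x y;
  ext_dist_eq0 : forall x y, ext_dist x y = 0 <-> x = y;
  ext_dist_sym : forall x y, ext_dist x y = ext_dist y x;
  ext_dist_triangle : forall x y z,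
    ext_dist x z <= ext_dist x y + ext_dist y z }.

Section precsim.
Variable R : realType.
Implicit Types X Y : extMetricSpace R.

Definition precsim X Y : Prop :=
  forall (N : nat) (x : 'I_N -> X),
    exists y : 'I_N -> nat -> Y,
      forall i j : 'I_N,
        ext_dist (x i) (x j) <= limn_einf (fun k => ext_dist (y i k) (y j k)).

Definition msim X Y : Prop := precsim X Y /\ precsim Y X.

End precsim.

(* A and B are meant to be nonempty: on empty sets, infima and suprema in \bar R
   take the values +oo and -oo. They have type T -> Prop rather than set T, and
   likewise below for families of metric spaces, because the universe of
   metricType lies strictly above the one of the argument of classical_sets.set. *)
Definition hausdorff_dist (R : realType) (T : Type) (d : T -> T -> \bar R)
    (A B : T -> Prop) : \bar R :=
  maxe (ereal_sup [set s | exists2 a, A a &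
          s = ereal_inf [set r | exists2 b, B b & r = d a b]])
       (ereal_sup [set s | exists2 b, B b &
          s = ereal_inf [set r | exists2 a, A a & r = d a b]]).

Record compactMetricSpace (R : realType) := CompactMetricSpace {
  cms_carrier :> metricType R;
  cms_nonempty : [set: cms_carrier] !=set0;
  cms_compact : compact [set: cms_carrier] }.

Section compact_metric_spaces.
Variable R : realType.
Implicit Types X Y : compactMetricSpace R.

Definition isometric_embedding (S T : metricType R) (f : S -> T) : Prop :=
  forall x y, mdist (f x) (f y) = mdist x y.

Definition isometric X Y : Prop :=
  exists2 f : X -> Y, isometric_embedding f & bijective f.

Definition isometry_class X : compactMetricSpace R -> Prop :=
  fun Y => isometric X Y.

Definition gh_dist X Y : \bar R :=
  ereal_inf [set h | exists (Z : metricType R) (f : X -> Z) (g : Y -> Z),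
    [/\ isometric_embedding f, isometric_embedding g &
        h = hausdorff_dist (fun a b : Z => (mdist a b)%:E)
              (range f) (range g)]].

Definition diameter X : \bar R :=
  ereal_sup [set (mdist p.1 p.2)%:E | p in [set: X * X]].

Section ext_of_metric.
Variable X : compactMetricSpace R.
Let d (x y : X) : \bar R := (mdist x y)%:E.

Let d_ge0 x y : 0 <= d x y.
Proof. by rewrite lee_fin mdist_ge0. Qed.

Let d_eq0 x y : d x y = 0 <-> x = y.
Proof.
by split=> [[]/mdist_positivity//|->]; rewrite /d mdistxx.
Qed.

Let d_sym x y : d x y = d y x.
Proof. by rewrite /d metric_sym. Qed.

Let d_triangle x y z : d x z <= d x y + d y z.
Proof. by rewrite -EFinD lee_fin metric_triangle. Qed.

Definition ext_of_metric : extMetricSpace R :=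
  ExtMetricSpace (cms_nonempty X) d_ge0 d_eq0 d_sym d_triangle.

End ext_of_metric.

(* The set H of isometry classes of nonempty compact metric spaces. *)
Definition GHspace : Type :=
  {C : compactMetricSpace R -> Prop | exists X, C = isometry_class X}.

(* A representative, by classical choice. It is used only through notions that
   are invariant under isometry. *)
Definition repr_class (C : GHspace) : compactMetricSpace R :=
  sval (cid (svalP C)).

Definition GH (C D : GHspace) : \bar R := gh_dist (repr_class C) (repr_class D).

Definition Hbound (N : nat) (D : R) (C : GHspace) : Prop :=
  ([set: repr_class C] #<= `I_N)%card /\ diameter (repr_class C) <= D%:E.

End compact_metric_spaces.

Section rho.
Variable R : realType.
Implicit Types X Y : extMetricSpace R.

Definition Pset X (C : GHspace R) : Prop :=
  precsim (ext_of_metric (repr_class C)) X.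

Definition rhoN (N : nat) X Y : \bar R :=
  hausdorff_dist (@GH R) (fun C => Pset X C /\ Hbound N N%:R C)
                         (fun C => Pset Y C /\ Hbound N N%:R C).

Definition rho X Y : \bar R :=
  \sum_(1 <= N <oo) (((2 : R) ^- N)%:E * rhoN N X Y).

End rho.

(* Main.v *)
Require Import Defs.
From HB Require Import structures.
From mathcomp Require Import all_boot all_order all_algebra.
From mathcomp Require Import all_classical all_reals all_analysis.
From mathcomp Require Import lra.

Set Implicit Arguments.
Unset Strict Implicit.
Unset Printing Implicit Defensive.

Import Order.TTheory GRing.Theory Num.Theory.
Import numFieldNormedType.Exports.

Local Open Scope classical_set_scope.
Local Open Scope ring_scope.
Local Open Scope ereal_scope.

(** Both directions rest on a reformulation of [precsim X Y] without limits:
    every finite system of strict lower bounds on distances that can be realised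
    by points of [X] can be realised by points of [Y] ([precsimP]).  In this form
    the relation is visibly transitive.

    If [X] and [Y] are equivalent, transitivity shows that the same compact
    spaces lie below [X] and below [Y]; each [rhoN] is then the Hausdorff
    distance of a nonempty set to itself, hence zero ([eq_rhoN0]).

    Conversely, [rho] is a series of nonnegative terms, so all [rhoN] vanish when
    it does ([rho_eq0]).  Given finitely many points of [X] and real strict lower
    bounds on their distances, take [M] larger than all these bounds and than the
    number of points.  The points with the distance [min(d, M)] form a finite
    metric space that satisfies the bounds, lies below [X], and has at most [M]
    points and diameter at most [M] ([finite_model]).  As [rhoN M X Y] is zero,
    there are spaces below [Y] at arbitrarily small Gromov-Hausdorff distance [e]
    from it, and passing to nearest points loses at most [2 * e] on distances
    ([gh_dist_lt]).  The bounds are strict and finite in number, so they survive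
    for small [e], first in a space below [Y], then in [Y] ([rhoN0_precsim]). *)

(** * Inferior limits of extended real sequences *)

Section limn_einf.
Variable R : realType.
Implicit Types (u v : (\bar R)^nat) (l : \bar R).

Lemma le_limn_einf u v :
  (forall k, u k <= v k) -> limn_einf u <= limn_einf v.
Proof.
move=> uv; rewrite !limn_einf_lim.
apply: lee_lim; [exact: is_cvg_einfs|exact: is_cvg_einfs|].
apply: nearW => n; apply: le_ereal_inf_tmp => _ [k nk <-].
by apply: le_trans (uv k); apply: ereal_inf_lbound; exists k.
Qed.

Lemma lt_limn_einf l u :
  l < limn_einf u -> \forall k \near \oo, l < u k.
Proof.
rewrite limn_einf_lim (cvg_lim _ (@cvg_einfs_sup R u))//.
move=> /ereal_sup_gt[_ [n _ <-] ln]; exists n => // k /= nk.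
by apply: lt_le_trans ln _; apply: ereal_inf_lbound; exists k.
Qed.

(** The value [+oo] is approached by the natural numbers, which is how infinite
    distances are reached by real lower bounds. *)
Lemma cvg_EFin_lt l : l != -oo ->
  exists2 c : R^nat, (forall k, (c k)%:E < l) & (c k)%:E @[k --> \oo] --> l.
Proof.
case: l => [r _|_|//].
- exists (fun k => r - k.+1%:R^-1)%R.
    by move=> k; rewrite lte_fin ltrBlDr ltrDl.
  apply: cvg_EFin; first exact: nearW.
  rewrite -[X in _ --> X]subr0.
  apply: cvgB; [exact: cvg_cst|exact: cvg_harmonic].
- exists (fun k => k%:R)%R; first by move=> k; rewrite ltry.
  exact/cvgeryP/cvgr_idn.
Qed.

End limn_einf.

(** * The relation precsim *)

Section precsim.
Variable R : realType.
Implicit Types X Y Z : extMetricSpace R.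

(** Only finitely many indices occur, so strict bounds on the inferior limits
    hold simultaneously at some late stage [k].  Conversely, if real bounds
    converge from below to the distances in [X], realising the [k]-th bounds in [Y] for
    each [k] gives sequences whose inferior limits dominate these distances. *)
Lemma precsimP X Y :
  precsim X Y <->
  forall (N : nat) (x : 'I_N -> X) (c : 'I_N -> 'I_N -> R),
    (forall i j, (c i j)%:E < ext_dist (x i) (x j)) ->
    exists y : 'I_N -> Y, forall i j, (c i j)%:E < ext_dist (y i) (y j).
Proof.
split=> [XY N x c cx|XY N x].
  have [y xy] := XY N x.
  have /filter_ex[k yk] : \forall k \near \oo,
      forall i j, (c i j)%:E < ext_dist (y i k) (y j k).
    apply: filter_forall => i; apply: filter_forall => j.
    exact: lt_limn_einf (lt_le_trans (cx i j) (xy i j)).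
  by exists (y^~ k).
have /choice[c cP] : forall p : 'I_N * 'I_N, exists c : R^nat,
    (forall k, (c k)%:E < ext_dist (x p.1) (x p.2)) /\
    (c k)%:E @[k --> \oo] --> ext_dist (x p.1) (x p.2).
  move=> p.
  have [|c ? ?] := @cvg_EFin_lt R (ext_dist (x p.1) (x p.2)); last by exists c.
  by rewrite gt_eqF// (lt_le_trans _ (ext_dist_ge0 _ _)).
(* Realise the k-th approximation of all the distances at once. *)
have /choice[y yP] : forall k, exists y : 'I_N -> Y,
    forall i j, (c (i, j) k)%:E < ext_dist (y i) (y j).
  move=> k; apply: (XY N x (fun i j => c (i, j) k)) => i j.
  exact: (cP (i, j)).1.
exists (fun i k => y k i) => i j.
have [_ cxy] := cP (i, j).
rewrite -[X in X <= _](cvg_lim _ cxy)// -is_cvg_limn_einfE; last first.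
  by apply/cvg_ex; eexists; exact: cxy.
by apply: le_limn_einf => k; exact/ltW/yP.
Qed.

Lemma precsim_trans Y X Z : precsim X Y -> precsim Y Z -> precsim X Z.
Proof.
move=> /precsimP XY /precsimP YZ; apply/precsimP => N x c cx.
by have [y cy] := XY N x c cx; exact: YZ cy.
Qed.

Lemma precsim_expanding X Y (f : X -> Y) :
  (forall x x', ext_dist x x' <= ext_dist (f x) (f x')) -> precsim X Y.
Proof.
move=> fP; apply/precsimP => N x c cx; exists (f \o x) => i j /=.
exact: lt_le_trans (fP _ _).
Qed.

End precsim.

(** * Hausdorff and Gromov-Hausdorff distances *)

Section hausdorff_dist.
Variables (R : realType) (T : Type) (d : T -> T -> \bar R).
Implicit Types A B : T -> Prop.

(** If [A] and [B] are both empty, both suprema are [-oo]. *)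
Lemma hausdorff_dist_ge0 A B : (forall a b, 0 <= d a b) ->
  (exists a, A a) -> 0 <= hausdorff_dist d A B.
Proof.
move=> d0 [a Aa]; rewrite /hausdorff_dist le_max; apply/orP; left.
apply: le_ereal_sup_tmp; eexists; first by exists a.
by apply: le_ereal_inf_tmp => _ [b _ ->].
Qed.

Lemma hausdorff_distC A B : (forall a b, d a b = d b a) ->
  hausdorff_dist d A B = hausdorff_dist d B A.
Proof.
move=> dC; rewrite /hausdorff_dist maxC.
by congr (maxe (ereal_sup _) (ereal_sup _)); apply/seteqP; split=> _ [a Aa ->];
  exists a => //; congr (ereal_inf _); apply/seteqP; split=> _ [b Bb ->];
  exists b.
Qed.

Lemma hausdorff_distxx A : (forall a b, 0 <= d a b) -> (forall a, d a a = 0) ->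
  (exists a, A a) -> hausdorff_dist d A A = 0.
Proof.
move=> d0 dxx A0; apply/eqP; rewrite eq_le hausdorff_dist_ge0// andbT.
rewrite /hausdorff_dist ge_max; apply/andP.
by split; apply: ge_ereal_sup => _ [a Aa ->]; apply: ereal_inf_lbound;
  exists a.
Qed.

Lemma hausdorff_dist_lt A B e a : hausdorff_dist d A B < e -> A a ->
  exists2 b, B b & d a b < e.
Proof.
rewrite /hausdorff_dist gt_max => /andP[ABe _] Aa.
have /ereal_inf_lt[_ [b Bb ->] dab] :
    ereal_inf [set r | exists2 b, B b & r = d a b] < e.
  by apply: le_lt_trans ABe; apply: ereal_sup_ubound; exists a.
by exists b.
Qed.

End hausdorff_dist.

Section gh_dist.
Variable R : realType.
Implicit Types X Y : compactMetricSpace R.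

Lemma gh_dist_ge0 X Y : 0 <= gh_dist X Y.
Proof.
rewrite /gh_dist; apply: le_ereal_inf_tmp => _ [Z [f [g [_ _ ->]]]].
apply: hausdorff_dist_ge0 => [a b|]; first by rewrite lee_fin mdist_ge0.
by have [x _] := cms_nonempty X; exists (f x), x.
Qed.

Lemma gh_distxx X : gh_dist X X = 0.
Proof.
apply/eqP; rewrite eq_le gh_dist_ge0 andbT; apply: ereal_inf_lbound.
exists X, id, id; split => //; rewrite hausdorff_distxx//.
- by move=> a b; rewrite lee_fin mdist_ge0.
- by move=> a; rewrite mdistxx.
- by have [x _] := cms_nonempty X; exists x, x.
Qed.

Lemma gh_distC X Y : gh_dist X Y = gh_dist Y X.
Proof.
suff sub (U V : compactMetricSpace R) : gh_dist U V <= gh_dist V U.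
  by apply/eqP; rewrite eq_le !sub.
rewrite /gh_dist.
apply: le_ereal_inf_tmp => _ [Z [f [g [fi gi ->]]]]; apply: ereal_inf_lbound.
exists Z, g, f; split => //.
by apply: hausdorff_distC => a b; rewrite metric_sym.
Qed.

(** Send [x] to a point of [Y] closer than [e] to it in a common ambient space;
    by the triangle inequality each endpoint costs at most [e]. *)
Lemma gh_dist_lt X Y (e : R) : gh_dist X Y < e%:E ->
  exists f : X -> Y, forall x x', (mdist x x' - 2 * e < mdist (f x) (f x'))%R.
Proof.
move=> /ereal_inf_lt[_ [Z [f [g [fi gi ->]]]] fge].
have /choice[h hP] : forall x, exists y, (mdist (f x) (g y) < e)%R.
  move=> x; have [|_ [y _ <-] fgy] := hausdorff_dist_lt fge (a := f x).
    by exists x.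
  by exists y; rewrite -lte_fin.
exists h => x x'; rewrite -fi -gi.
have := metric_triangle (f x) (g (h x)) (f x').
have := metric_triangle (g (h x)) (g (h x')) (f x').
have := hP x; have := hP x'; rewrite (metric_sym (g (h x')) (f x')).
by move: (mdist _ _) (mdist _ _) (mdist _ _) (mdist _ _) (mdist _ _) => *; lra.
Qed.

End gh_dist.

(** * Finite subspaces with truncated distance *)

Section truncation.
Variables (R : realType) (X : extMetricSpace R).
Variables (S : X -> Prop) (M : R) (M_gt0 : (0 < M)%R).

(** Truncating at [M] turns a possibly infinite distance into a real one and
    keeps the triangle inequality.  The proof that [M] is positive is an argument
    of the type because distinct points are kept apart only when [M] is positive,
    so the metric structure depends on it. *)
Definition truncated_subspace of (0 < M)%R := {z : X | S z}.
Local Notation T := (truncated_subspace M_gt0).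

Definition truncated_dist (z w : T) : R :=
  fine (mine (ext_dist (sval z) (sval w)) M%:E).

Lemma truncated_distE z w :
  (truncated_dist z w)%:E = mine (ext_dist (sval z) (sval w)) M%:E.
Proof.
rewrite fineK// ge0_fin_numE; first by rewrite gt_min ltry orbT.
by rewrite le_min ext_dist_ge0 lee_fin ltW.
Qed.

Let dxx z : truncated_dist z z = 0%R.
Proof.
apply: EFin_inj; rewrite truncated_distE.
by rewrite (ext_dist_eq0 _ _).2// min_l// lee_fin ltW.
Qed.

Let dpos z w : truncated_dist z w = 0%R -> z = w.
Proof.
move=> zw0.
have : mine (ext_dist (sval z) (sval w)) M%:E = 0.
  by rewrite -truncated_distE zw0.
rewrite minEle; case: ifP => [_ /ext_dist_eq0 zw|_ [] M0]; last first.
  by have := M_gt0; rewrite M0 ltxx.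
apply: eq_sig_hprop; first by move=> ? ? ?; exact: Prop_irrelevance.
exact: zw.
Qed.

Let dsym z w : truncated_dist z w = truncated_dist w z.
Proof. by rewrite /truncated_dist ext_dist_sym. Qed.

Let dtri w z t :
  (truncated_dist z t <= truncated_dist z w + truncated_dist w t)%R.
Proof.
rewrite -lee_fin EFinD !truncated_distE.
have M0 : 0 <= M%:E by rewrite lee_fin ltW.
have m0 (a b : X) : 0 <= mine (ext_dist a b) M%:E.
  by rewrite le_min ext_dist_ge0.
(* If a summand on the right is truncated, it equals M, which bounds the left-hand
   side. *)
rewrite [X in _ <= X + _]minEle; case: ifPn => [_|_]; last first.
  by rewrite ge_min leeDl ?orbT.
rewrite [X in _ <= _ + X]minEle; case: ifPn => [_|_]; last first.
  by rewrite ge_min leeDr ?orbT// ext_dist_ge0.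
by rewrite ge_min ext_dist_triangle.
Qed.

HB.instance Definition _ := gen_eqMixin T.
HB.instance Definition _ := gen_choiceMixin T.
HB.instance Definition _ := @isMetric.Build R T truncated_dist dxx dpos dsym dtri.

End truncation.

Section finite_model.
Variable R : realType.
Implicit Types X : extMetricSpace R.

(** The representative of the isometry class of [F] is a chosen space that need
    not be [F], so properties of [F] must be transported along an isometry. *)
Lemma GH_repr (F : compactMetricSpace R) :
  exists C : GHspace R, isometric F (repr_class C).
Proof.
pose C : GHspace R := exist _ (isometry_class F) (ex_intro _ F erefl).
exists C; rewrite -[isometric _ _]/(isometry_class F (repr_class C)).
rewrite -[isometry_class F]/(sval C) /repr_class.
case: cid => /= F' ->; exists id => //; exact: inv_bij.
Qed.

(** The carrier is the set of values of [x] rather than its index set: repeated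
    points would otherwise be distinct points at distance zero. *)
Lemma finite_model X n (x : 'I_n.+1 -> X) (M : nat) : (n < M)%N ->
  exists2 C : GHspace R, Pset X C /\ Hbound M M%:R C &
    exists g : 'I_n.+1 -> repr_class C,
      forall i j, (mdist (g i) (g j))%:E = mine (ext_dist (x i) (x j)) M%:R%:E.
Proof.
move=> nM.
have M0 : (0 < M%:R :> R)%R by rewrite ltr0n (leq_ltn_trans _ nM).
pose T := @truncated_subspace R X (fun z => exists i, x i = z) M%:R M0.
pose p (i : 'I_n.+1) : T := exist _ (x i) (ex_intro _ i erefl).
have pP : range p = [set: T].
  apply/seteqP; split=> // -[z [i xz]] _; exists i => //.
  by apply: eq_sig_hprop => //= ? ? ?; exact: Prop_irrelevance.
have Tn : ([set: T] #<= `I_n.+1)%card.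
  rewrite -pP; apply: card_le_trans (card_image_le _ _) _.
  by have := @card_II n.+1; rewrite card_eq_le => /andP[].
have T0 : [set: T] !=set0 by exists (p ord0).
have Tc : compact [set: T].
  by apply: finite_compact; apply: card_le_finite Tn _; exact: finite_II.
have [C [f fi fb]] := GH_repr (CompactMetricSpace T0 Tc).
have [f' ff' f'f] := fb.
have fd z w : (mdist (f z) (f w))%:E = mine (ext_dist (sval z) (sval w)) M%:R%:E.
  by rewrite fi; exact: truncated_distE.
exists C; last by exists (f \o p) => i j; rewrite /= fd.
split; [|split].
- rewrite /Pset.
  apply: (@precsim_expanding _ (ext_of_metric _) X (fun c => sval (f' c))) => c c'.
  by rewrite /= -{1}(f'f c) -{1}(f'f c') fd ge_min lexx.
- have <- : range f = [set: repr_class C].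
    by apply/seteqP; split=> // c _; exists (f' c).
  apply: card_le_trans (card_image_le _ _) _.
  by apply: card_le_trans Tn _; rewrite card_le_II.
- apply: ge_ereal_sup => _ [[c c'] _ <-] /=.
  by rewrite -(f'f c) -(f'f c') fd ge_min lexx orbT.
Qed.

End finite_model.

(** * The pseudometric rho *)

Section rho.
Variable R : realType.
Implicit Types X Y : extMetricSpace R.

Lemma rhoNC N X Y : rhoN N X Y = rhoN N Y X.
Proof. by apply: hausdorff_distC => C D; exact: gh_distC. Qed.

(** The one-point space is below every [X]. *)
Lemma rhoN_domain_nonempty N X : (0 < N)%N ->
  exists C : GHspace R, Pset X C /\ Hbound N N%:R C.
Proof.
move=> N0; have [x _] := ext_nonempty X.
by have [C CX _] := finite_model (fun=> x) N0; exists C.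
Qed.

Lemma rhoN_ge0 N X Y : (0 < N)%N -> 0 <= rhoN N X Y.
Proof.
move=> N0; apply: hausdorff_dist_ge0; last exact: rhoN_domain_nonempty.
by move=> C D; exact: gh_dist_ge0.
Qed.

Lemma rho_eq0 X Y :
  rho X Y = 0 <-> forall N, (0 < N)%N -> rhoN N X Y = 0.
Proof.
have pow_gt0 N : (0 < (2 : R) ^- N)%R by rewrite invr_gt0 exprn_gt0.
have term_ge0 N : (0 < N)%N -> 0 <= ((2 : R) ^- N)%:E * rhoN N X Y.
  by move=> N0; rewrite mule_ge0 ?rhoN_ge0// lee_fin ltW.
split=> [rho0 N N0|rhoN0]; last first.
  by rewrite /rho eseries0// => N N0 _; rewrite rhoN0// mule0.
apply/eqP; rewrite eq_le rhoN_ge0// andbT.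
rewrite -(pmule_rle0 _ (_ : 0 < ((2 : R) ^- N)%:E)) ?lte_fin// -rho0.
apply: le_trans (nneseries_lim_ge N.+1 _); last by move=> k k0 _; exact: term_ge0.
rewrite big_nat_recr//= leeDr// big_nat_cond sume_ge0// => k.
by rewrite andbT => /andP[k0 _]; exact: term_ge0.
Qed.

Lemma eq_rhoN0 N X Y : (0 < N)%N -> msim X Y -> rhoN N X Y = 0.
Proof.
move=> N0 [XY YX].
have -> : rhoN N X Y = rhoN N X X.
  congr hausdorff_dist; apply/funext => C; apply/propext.
  by split=> -[CZ CN]; split=> //; exact: precsim_trans CZ _.
apply: hausdorff_distxx; last exact: rhoN_domain_nonempty.
- by move=> C D; exact: gh_dist_ge0.
- by move=> C; exact: gh_distxx.
Qed.

(** Finite samples of [X] are matched, up to an arbitrarily small error, inside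
    spaces that lie below [Y]. *)
Lemma rhoN0_precsim X Y :
  (forall N, (0 < N)%N -> rhoN N X Y = 0) -> precsim X Y.
Proof.
move=> rho0; apply/precsimP => -[|n] x c cx.
  by have [y _] := ext_nonempty Y; exists (fun=> y) => -[].
have near_c : \forall M \near \oo, forall i j, (c i j < M%:R)%R.
  apply: filter_forall => i; apply: filter_forall => j.
  exact: nbhs_infty_gtr.
have [M [nM cM]] := filter_ex (filterI (nbhs_infty_gt n) near_c).
have M0 : (0 < M)%N by exact: leq_ltn_trans nM.
have [C CX [g gP]] := finite_model x nM.
have cg i j : (c i j < mdist (g i) (g j))%R.
  by rewrite -lte_fin gP lt_min cx lte_fin cM.
(* Half of the slack, since passing to nearest points loses up to 2 * e. *)
have near_e : \forall e \near 0%R^'+,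
    forall i j, (e < (mdist (g i) (g j) - c i j) / 2)%R.
  apply: filter_forall => i; apply: filter_forall => j.
  by apply: nbhs_right_lt; rewrite divr_gt0// subr_gt0.
have [e [e0 eP]] := filter_ex (filterI (nbhs_right_gt 0%R) near_e).
have rho_lt : rhoN M X Y < e%:E by rewrite rho0// lte_fin.
have [D [/precsimP DY _] /gh_dist_lt[f fP]] := hausdorff_dist_lt rho_lt CX.
apply: (DY _ (f \o g)) => i j; rewrite lte_fin; apply: le_lt_trans (fP _ _).
by have := eP i j; lra.
Qed.

End rho.

Theorem corollary3p15 (R : realType) (X Y : extMetricSpace R) :
  rho X Y = 0%E <-> msim X Y.
Proof.
rewrite rho_eq0; split=> [rho0|XY N N0]; last exact: eq_rhoN0.
split; apply: rhoN0_precsim => // N N0; rewrite rhoNC; exact: rho0.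
Qed.
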